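(* $\bigcup_{\sigma>0}\mathcal{C}(\sigma)\subsetneqq C^\infty([0,L]^2;\mathbb{R}^2)\cap H$.
   Context: $H$ is the closure in $L^2([0,L]^2)^2$ of the $\mathbb{R}^2$-valued $[0,L]^2$-periodic trigonometric polynomials $v$ with $\nabla\cdot v=0$ and $\int v\,dx=0$, with norm $|\cdot|$; $A=-\Delta$ is the Stokes operator with spectrally defined powers $A^{\alpha/2}$. Fix $\nu>0$ and $\kappa_0=2\pi/L$. For $\sigma>0$, $\mathcal{C}(\sigma)$ is the set of $u\in C^\infty([0,L]^2)\cap H$ for which there is $c_0=c_0(u)\in\mathbb{R}$ with $\frac{|A^{\alpha/2}u|^2}{\nu^2\kappa_0^{2\alpha}}\le c_0e^{\sigma\alpha^2}$ for all $\alpha\in\mathbb{N}$. *)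

(* Defs.v *)
From mathcomp Require Import all_boot all_order all_algebra.
From mathcomp Require Import all_classical all_reals all_analysis.
Set Implicit Arguments. Unset Strict Implicit. Unset Printing Implicit Defensive.
Import Order.TTheory GRing.Theory Num.Theory.
Import numFieldNormedType.Exports.
Local Open Scope classical_set_scope.
Local Open Scope ring_scope.

Section NSE_defs.
Context {R : realType}.

Definition vfield := R -> R -> R * R.

Definition pd (b : bool) (f : R -> R -> R) : R -> R -> R :=
  fun x y => if b then derive1 (fun t => f t y) x else derive1 (fun t => f x t) y.

Definition iter_pd (w : seq bool) (f : R -> R -> R) := foldr pd f w.

Definition smooth2 (f : R -> R -> R) : Prop :=
  forall w : seq bool,
    continuous (fun p : R * R => iter_pd w f p.1 p.2) /\
    forall x y, derivable (fun t => iter_pd w f t y) x 1 /\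
                derivable (fun t => iter_pd w f x t) y 1.

Definition comp1 (u : vfield) : R -> R -> R := fun x y => (u x y).1.
Definition comp2 (u : vfield) : R -> R -> R := fun x y => (u x y).2.

Definition periodic2 (L : R) (u : vfield) : Prop :=
  forall x y, u (x + L) y = u x y /\ u x (y + L) = u x y.

(* u in C^oo([0,L]^2; R^2), understood as [0,L]^2-periodic smooth fields *)
Definition smooth_per (L : R) (u : vfield) : Prop :=
  periodic2 L u /\ smooth2 (comp1 u) /\ smooth2 (comp2 u).

Definition sq_int (L : R) (f : R -> R -> R) : R :=
  \int[lebesgue_measure]_(x in `[0, L]) \int[lebesgue_measure]_(y in `[0, L]) f x y.

Definition kappa0 (L : R) : R := 2 * pi / L.

Definition phase (L : R) (k : int * int) (x y : R) : R :=
  kappa0 L * (k.1%:~R * x + k.2%:~R * y).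

Definition trigpoly (L : R) (s : seq ((int * int) * (R * R) * (R * R))) : vfield :=
  fun x y =>
    (\sum_(t <- s) (cos (phase L t.1.1 x y) * t.1.2.1 + sin (phase L t.1.1 x y) * t.2.1),
     \sum_(t <- s) (cos (phase L t.1.1 x y) * t.1.2.2 + sin (phase L t.1.1 x y) * t.2.2)).

Definition div_free (u : vfield) : Prop :=
  forall x y, pd true (comp1 u) x y + pd false (comp2 u) x y = 0.

Definition mean_zero (L : R) (u : vfield) : Prop :=
  sq_int L (comp1 u) = 0 /\ sq_int L (comp2 u) = 0.

Definition L2dist2 (L : R) (u v : vfield) : R :=
  sq_int L (fun x y => (comp1 u x y - comp1 v x y) ^+ 2 + (comp2 u x y - comp2 v x y) ^+ 2).

Definition inH (L : R) (u : vfield) : Prop :=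
  forall eps : R, 0 < eps ->
    exists s, div_free (trigpoly L s) /\ mean_zero L (trigpoly L s) /\
              L2dist2 L u (trigpoly L s) < eps.

Definition ccoef (L : R) (k : int * int) (f : R -> R -> R) : R :=
  sq_int L (fun x y => f x y * cos (phase L k x y)).
Definition scoef (L : R) (k : int * int) (f : R -> R -> R) : R :=
  sq_int L (fun x y => f x y * sin (phase L k x y)).

(* |A^{alpha/2} u|^2, spectrally: sum over k in Z^2 of
   (kappa0^2 |k|^2)^alpha |hat u_k|^2 L^2, written with real coefficients. *)
Definition normA2 (L : R) (alpha : nat) (u : vfield) : \bar R :=
  \esum_(k in [set: int * int])
    (((kappa0 L ^+ 2 * (k.1%:~R ^+ 2 + k.2%:~R ^+ 2)) ^+ alpha *
      ((ccoef L k (comp1 u)) ^+ 2 + (ccoef L k (comp2 u)) ^+ 2 +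
       (scoef L k (comp1 u)) ^+ 2 + (scoef L k (comp2 u)) ^+ 2) / L ^+ 2)%:E).

Definition classC (L nu sigma : R) (u : vfield) : Prop :=
  smooth_per L u /\ inH L u /\
  exists c0 : R, forall alpha : nat,
    (normA2 L alpha u * ((nu ^+ 2 * kappa0 L ^+ (2 * alpha))^-1)%:E
       <= (c0 * expR (sigma * (alpha%:R) ^+ 2))%:E)%E.

End NSE_defs.

(* Main.v *)
(** The witness is the shear flow u(x,y) = (g(y), 0) with the lacunary profile
    g(y) = sum_n 2^(-n^3) cos(kappa_0 2^(n^2) y). The amplitudes decay faster
    than any power of the frequencies, so g is smooth and its partial sums
    approximate u in L^2 by divergence-free trigonometric polynomials. The single
    mode k = (0, 2^(n^2)) already makes |A^(alpha/2) u|^2 / kappa_0^(2 alpha) at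
    least a constant times 2^(2 n^2 alpha - 2 n^3); for alpha = 2n this is
    2^(2 n^3), cubic in alpha in the exponent, which no c_0 exp(sigma alpha^2)
    dominates. *)

Require Import Defs.
From mathcomp Require Import all_boot all_order all_algebra.
From mathcomp Require Import all_classical all_reals all_analysis.
From mathcomp Require Import ring lra zify.
Import Order.TTheory GRing.Theory Num.Theory.
Import numFieldNormedType.Exports.
Local Open Scope ring_scope.

(** * Cosine series with nonnegative summable coefficients: truncation error and termwise
    differentiation *)

Section CosineSeries.
Context {R : realType}.
Local Open Scope classical_set_scope.
Implicit Types (c lam : nat -> R) (x h t theta : R).

Lemma sin_lipschitz x t : `|sin x - sin t| <= `|x - t|.
Proof.
wlog le_tx : x t / t <= x.
  by move=> H; case/orP: (le_total t x) => /H //; rewrite distrC [`|x - t|]distrC.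
have [|s _ ->] := @MVT_segment R sin cos t x le_tx (fun y _ => is_derive_sin y).
  by apply: continuous_subspaceT; exact: continuous_sin.
by rewrite normrM ler_piMl// cos_max.
Qed.

(** By the mean value theorem the error is [h * (sin x - sin s)] with [s] between [x] and [x + h],
    and the Lipschitz bound on [sin] supplies the second factor [h]. *)
Lemma cos_taylor1 x h : `|cos (x + h) - cos x + h * sin x| <= h ^+ 2.
Proof.
have bound (a b s : R) : a <= b -> s \in `[a, b]%R -> forall y, y \in `[a, b]%R ->
    `|(- sin s + sin y) * (b - a)| <= (b - a) ^+ 2.
  move=> ab; rewrite in_itv/= => /andP[as_ sb] y; rewrite in_itv/= => /andP[ay yb].
  rewrite normrM expr2 [`|b - a|]ger0_norm ?subr_ge0// ler_wpM2r ?subr_ge0//.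
  rewrite [- sin s + _]addrC; apply: le_trans (sin_lipschitz _ _) _.
  by rewrite ler_norml; apply/andP; split; lra.
have mvt (a b : R) : a <= b ->
    exists2 s, s \in `[a, b]%R & cos b - cos a = - sin s * (b - a).
  move=> ab; apply: (@MVT_segment R cos (fun y => - sin y)) => //.
  by apply: continuous_subspaceT; exact: continuous_cos.
(* The mean value theorem wants ordered endpoints; [x] is the left one or the right one according to
   the sign of [h]. *)
case/orP: (le_total 0 h) => h0.
- have ab : x <= x + h by rewrite lerDl.
  have [s si e] := mvt _ _ ab.
  have xi : x \in `[x, x + h]%R by rewrite in_itv/= lexx.
  have := bound _ _ _ ab si _ xi.
  by rewrite mulrDl -e [x + h - x](_ : _ = h) ?[sin x * h]mulrC//; ring.
- have ab : x + h <= x by rewrite gerDl.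
  have [s si e] := mvt _ _ ab.
  have xi : x \in `[x + h, x]%R by rewrite in_itv/= lexx ab.
  have := bound _ _ _ ab si _ xi.
  rewrite mulrDl -e [x - (x + h)](_ : _ = - h); last by ring.
  by rewrite sqrrN -normrN; congr (`|_| <= _); ring.
Qed.

(* The free phase [theta] makes the family closed under differentiation, which
   shifts it by pi/2. *)
Definition cosine_series c lam theta t : R :=
  limn (series (fun n => c n * cos (lam n * t + theta))).

Lemma is_cvg_cosine_series c lam theta t :
  (forall n, 0 <= c n) -> cvgn (series c) ->
  cvgn (series (fun n => c n * cos (lam n * t + theta))).
Proof.
move=> c0 cc; apply: normed_cvg; apply: series_le_cvg cc => // n; rewrite /= ?normr_ge0//.
by rewrite normrM ger0_norm// ler_piMr// cos_max.
Qed.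

(** With [f] the terms of the cosine series, [c - f] and [c + f] are both nonnegative, so their
    partial sums lie below their limits. These two inequalities are the two sides of the absolute
    value. *)
Lemma cosine_series_tail c lam theta t M :
  (forall n, 0 <= c n) -> cvgn (series c) ->
  `|cosine_series c lam theta t -
    \sum_(n < M) c n * cos (lam n * t + theta)| <= limn (series c) - series c M.
Proof.
move=> c0 cc; set f := fun n => c n * cos (lam n * t + theta).
have fc n : `|f n| <= c n by rewrite normrM ger0_norm// ler_piMr// cos_max.
have cf : cvgn (series f) by exact: is_cvg_cosine_series.
have -> : \sum_(n < M) c n * cos (lam n * t + theta) = series f M.
  by rewrite /series/= big_mkord.
have one_sided (g : nat -> R) : cvgn (series g) -> (forall n, 0 <= g n) ->
    series g M <= limn (series g).
  move=> cg g0; apply: nondecreasing_cvgn_le cg M.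
  exact: nondecreasing_series.
have cBf n : 0 <= (c - f) n by rewrite !fctE subr_ge0 (le_trans (ler_norm _)).
have cDf n : 0 <= (c + f) n.
  by rewrite !fctE -[f n]opprK subr_ge0 (le_trans (ler_norm _))// normrN.
have := one_sided _ (is_cvg_seriesB cc cf) cBf.
rewrite lim_seriesB// seriesD seriesN !fctE => H1.
have := one_sided _ (is_cvg_seriesD cc cf) cDf.
rewrite lim_seriesD// seriesD !fctE => H2.
rewrite /cosine_series -/f ler_norml.
by apply/andP; split; lra.
Qed.

Lemma is_derive_cosine_series c lam theta t :
  (forall n, 0 <= c n) -> (forall n, 0 <= lam n) ->
  cvgn (series c) -> cvgn (series (fun n => c n * lam n)) ->
  cvgn (series (fun n => c n * lam n ^+ 2)) ->
  is_derive t 1 (cosine_series c lam theta)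
    (cosine_series (fun n => c n * lam n) lam (theta + pi / 2) t).
Proof.
move=> c0 l0 cc cl cl2.
set G := cosine_series c lam theta; set G' := cosine_series _ lam _.
set B := limn (series (fun n => c n * lam n ^+ 2)).
have cl0 n : 0 <= c n * lam n by exact: mulr_ge0.
have taylor h : `|G (t + h) - G t - h * G' t| <= h ^+ 2 * B.
  pose f := fun n => c n * cos (lam n * (t + h) + theta).
  pose g := fun n => c n * cos (lam n * t + theta).
  pose k := fun n => c n * lam n * cos (lam n * t + (theta + pi / 2)).
  have cf : cvgn (series f) by exact: is_cvg_cosine_series.
  have cg : cvgn (series g) by exact: is_cvg_cosine_series.
  have ck : cvgn (series k) by exact: is_cvg_cosine_series.
  have cfg : cvgn (series (f - g)) := is_cvg_seriesB cf cg.
  have chk : cvgn (series (h *: k)) by apply: (@is_cvg_seriesZ _ k h).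
  have -> : G (t + h) - G t - h * G' t = limn (series (f - g - h *: k)).
    by rewrite lim_seriesB// lim_seriesB// lim_seriesZ.
  (* The Taylor bound is used with increment [lam n * h], hence the factor [lam n ^+ 2]. The phase
     shift turns the cosine in [k] into minus a sine, which explains the sign in the rewritten
     term. *)
  have bnd n : `|(f - g - h *: k) n| <= h ^+ 2 * (c n * lam n ^+ 2).
    rewrite (_ : (f - g - h *: k) n = c n * (cos (lam n * t + theta + lam n * h)
       - cos (lam n * t + theta) + lam n * h * sin (lam n * t + theta))); last first.
      rewrite !fctE /f /g /k addrA cosDpihalf.
      rewrite (_ : lam n * (t + h) + theta = lam n * t + theta + lam n * h); last by ring.
      by rewrite /GRing.scale/=; ring.
    rewrite normrM ger0_norm// mulrCA ler_wpM2l//.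
    by apply: le_trans (cos_taylor1 _ _) _; rewrite exprMn mulrC.
  have cb : cvgn (series (h ^+ 2 *: (fun n => c n * lam n ^+ 2))).
    exact: is_cvg_seriesZ.
  have cn : cvgn [normed series (f - g - h *: k)].
    apply: series_le_cvg cb => // n; first exact: normr_ge0.
    by apply: mulr_ge0 (sqr_ge0 _) (mulr_ge0 (c0 _) (sqr_ge0 _)).
  apply: le_trans (lim_series_norm cn) _.
  rewrite -[X in _ <= X]/(h ^+ 2 *: B) -lim_seriesZ//.
  exact: lim_series_le.
have B0 : 0 <= B.
  by have := le_trans (normr_ge0 _) (taylor 1); rewrite expr1n mul1r.
have cvgG : h^-1 *: ((G \o shift t) (h *: 1) - G t) @[h --> 0^'] --> G' t.
  apply/cvgrPdist_le => /= e e0.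
  (* [B] may vanish, so the radius is taken with [B + 1]. *)
  have d0 : 0 < e / (B + 1) by rewrite divr_gt0// ltr_wpDl.
  near=> h.
  have h0 : h != 0 by near: h; exact: nbhs_dnbhs_neq.
  have hd : `|h| <= e / (B + 1).
    by near: h; apply: dnbhs0_le.
  rewrite distrC (_ : _ - _ = h^-1 * (G (t + h) - G t - h * G' t)); last first.
    rewrite /= /GRing.scale/= mulr1 [h + t]addrC.
    by field.
  rewrite normrM normfV ler_pdivrMl ?normr_gt0//.
  apply: le_trans (taylor h) _.
  rewrite -(real_normK (num_real h)) expr2 -mulrA ler_wpM2l//.
  move: hd; rewrite ler_pdivlMr ?ltr_wpDl// mulrDr mulr1.
  by apply: le_trans; rewrite lerDl.
split.
  by apply/cvg_ex; exists (G' t).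
by apply: cvg_lim.
Unshelve. all: by end_near. Qed.

End CosineSeries.

(** * Integrals over a period of functions of [y] alone, and orthogonality of the cosines *)

Section ShearFlow.
Context {R : realType}.
Variable L : R.
Hypothesis L0 : 0 < L.
Local Open Scope classical_set_scope.
Implicit Types f g h : R -> R.

Local Notation I f := (\int[lebesgue_measure]_(y in `[0, L]) f y).

Lemma integrable_continuous f : continuous f ->
  lebesgue_measure.-integrable `[0, L] (EFin \o f).
Proof.
move=> cf; apply: continuous_compact_integrable; first exact: segment_compact.
exact: continuous_subspaceT.
Qed.

Lemma Rintegral_const (r : R) : \int[lebesgue_measure]_(y in `[0, L]) r = r * L.
Proof.
rewrite Rintegral_cst//; congr (_ * _).
by rewrite /= lebesgue_measure_itv/= lte_fin L0 -EFinB/= subr0.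
Qed.

Lemma sq_int_shear f : sq_int L (fun _ y => f y) = I f * L.
Proof. by rewrite /sq_int Rintegral_const. Qed.

Lemma Rintegral_norm_le f (e : R) : continuous f -> (forall y, `|f y| <= e) ->
  `|I f| <= e * L.
Proof.
move=> cf fe; rewrite -Rintegral_const.
apply: (le_trans (le_normr_Rintegral _ (integrable_continuous _ cf))) => //.
apply: le_Rintegral => //.
- by apply: (@integrable_continuous (fun y => `|f y|)) => y; exact: cvg_norm (cf y).
- by apply: (@integrable_continuous (cst e)) => y; exact: cvg_cst.
Qed.

Lemma is_derive_sin_scale (a x : R) : a != 0 ->
  is_derive x 1 (fun t => a^-1 * sin (a * t)) (cos (a * x)).
Proof.
move=> a0.
have d1 : is_derive x 1 (fun t : R => a * t) a.
  by rewrite -[X in is_derive _ _ _ X]mulr1; exact: (is_deriveZ a (is_derive_id x 1)).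
have d2 := is_derive1_comp (is_derive_sin (a * x)) d1.
have d3 : is_derive x 1 (fun t => a^-1 * sin (a * t)) (a^-1 *: (cos (a * x) * a)).
  exact: (is_deriveZ a^-1 d2).
by apply: is_derive_eq; rewrite /GRing.scale/= mulrCA mulVf// mulr1.
Qed.

(** The antiderivative [a^-1 * sin (a * t)] vanishes at both ends of the interval. *)
Lemma Rintegral_cos (a : R) : a != 0 -> sin (a * L) = 0 ->
  I (fun y => cos (a * y)) = 0.
Proof.
move=> a0 saL.
pose F := fun t => a^-1 * sin (a * t).
have dF (x : R) : is_derive x 1 F (cos (a * x)) by exact: is_derive_sin_scale.
have cF : continuous F.
  by move=> x; apply/differentiable_continuous/derivable1_diffP; exact: ex_derive.
have cc : continuous (fun y => cos (a * y)).
  move=> x; apply: (@continuous_comp _ _ _ (fun y : R => a * y) cos).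
    exact: mulrl_continuous.
  exact: continuous_cos.
rewrite /Rintegral (@continuous_FTC2 R _ F)//.
- by rewrite /F saL !mulr0 sin0 mulr0 sube0.
- exact: continuous_subspaceT.
- split.
  + by move=> x _; exact: ex_derive.
  + by apply: cvg_at_right_filter; exact: cF.
  + by apply: cvg_at_left_filter; exact: cF.
- by move=> x _; rewrite derive1E derive_val.
Qed.

Definition wave (n : nat) : R := kappa0 L * n%:R.

Lemma kappa0_gt0 : 0 < kappa0 L.
Proof. by rewrite divr_gt0// mulr_gt0// pi_gt0. Qed.

Lemma wave_period n : wave n * L = (pi *+ 2) *+ n.
Proof.
rewrite /wave /kappa0 -(mulr_natr _ n) -(mulr_natl pi 2).
by field; rewrite gt_eqF.
Qed.

Lemma sin_wave_period n : sin (wave n * L) = 0.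
Proof.
by rewrite wave_period -[_ *+ n]add0r periodicn ?sin0//; exact: sinD2pi.
Qed.

Lemma Rintegral_cos_wave n : (0 < n)%N -> I (fun y => cos (wave n * y)) = 0.
Proof.
move=> n0; apply: Rintegral_cos (sin_wave_period n).
by rewrite mulf_neq0// ?pnatr_eq0 -?lt0n// gt_eqF// kappa0_gt0.
Qed.

Lemma continuous_cos_wave n : continuous (fun y => cos (wave n * y)).
Proof.
move=> x; apply: (@continuous_comp _ _ _ (fun y : R => wave n * y) cos).
  exact: mulrl_continuous.
exact: continuous_cos.
Qed.

(** Product-to-sum leaves the frequencies [m - n] and [m + n]. Positivity of [n] makes the second
    integrate to 0; the first does so too unless [m = n], when it is the constant 1. *)
Lemma Rintegral_cos_wave_mul m n : (0 < n)%N ->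
  I (fun y => cos (wave m * y) * cos (wave n * y)) = (m == n)%:R * (L / 2).
Proof.
wlog le_nm : m n / (n <= m)%N.
  move=> H n0; case/orP: (leq_total n m) => [le|le]; first exact: H.
  (* Exchanging the two factors requires [m] positive. For [m = 0] the first factor is 1 and a
     single wave is left. *)
  case: (posnP m) => [->|m0].
    rewrite [_ == _](_ : _ = false) ?mul0r; last by apply/negbTE; rewrite eq_sym -lt0n.
    rewrite -[RHS](Rintegral_cos_wave _ n0); apply: eq_Rintegral => y _.
    by rewrite /wave mulr0 mul0r cos0 mul1r.
  rewrite eq_sym -H//; apply: eq_Rintegral => y _; exact: mulrC.
move=> n0.
have -> : I (fun y => cos (wave m * y) * cos (wave n * y)) =
    I (fun y => 2^-1 * (cos (wave (m - n) * y) + cos (wave (m + n) * y))).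
  apply: eq_Rintegral => y _.
  rewrite (_ : wave (m - n) * y = wave m * y - wave n * y); last first.
    by rewrite /wave natrB//; ring.
  rewrite (_ : wave (m + n) * y = wave m * y + wave n * y); last first.
    by rewrite /wave natrD; ring.
  by rewrite cosB cosD; field.
rewrite RintegralZl//; last first.
  apply: (@integrable_continuous (fun y => cos (wave (m - n) * y) + cos (wave (m + n) * y))) => y.
  by apply: cvgD; exact: continuous_cos_wave.
rewrite RintegralD//; last 2 first.
- exact: (integrable_continuous _ (continuous_cos_wave _)).
- exact: (integrable_continuous _ (continuous_cos_wave _)).
rewrite (Rintegral_cos_wave (m + n)) ?addn_gt0 ?n0 ?orbT// addr0.
have [->|ne] := eqVneq m n.
  rewrite subnn mul1r mulrC -[L in RHS]mul1r -Rintegral_const; congr (_ * _).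
  by apply: eq_Rintegral => y _; rewrite /wave mulr0 mul0r cos0.
by rewrite Rintegral_cos_wave ?mulr0 ?mul0r// subn_gt0 ltn_neqAle eq_sym ne.
Qed.

End ShearFlow.

(** * Smoothness and incompressibility of shear flows *)

Section SmoothShear.
Context {R : realType}.
Local Open Scope classical_set_scope.

Definition shear (f : R -> R) : @vfield R := fun _ y => (f y, 0).

(** Lists all derivatives of [G 0] explicitly, which turns smoothness into data that an induction
    can carry along. *)
Definition derive_chain (G : nat -> R -> R) :=
  forall (j : nat) (t : R), is_derive t 1 (G j) (G j.+1 t).

Lemma derive_chain_shift (G : nat -> R -> R) :
  derive_chain G -> derive_chain (fun j => G j.+1).
Proof. by move=> dG j t; exact: dG. Qed.

Lemma derive_chain0 : derive_chain (fun _ _ => 0).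
Proof. by move=> j t; exact: is_derive_cst. Qed.

(** The invariant is being a function of [y] alone that heads a chain: a derivative in [x] replaces
    the chain by zero, a derivative in [y] shifts it by one. *)
Lemma iter_pd_shear (w : seq bool) (G : nat -> R -> R) : derive_chain G ->
  exists2 H, derive_chain H & iter_pd w (fun _ y => G 0%N y) = fun _ y => H 0%N y.
Proof.
move=> dG; elim: w => [|b w [H dH e]]; first by exists G.
rewrite /= -/(iter_pd w _) e; case: b.
- exists (fun _ _ => 0); first exact: derive_chain0.
  by apply/funext => x; apply/funext => y; rewrite /pd derive1_cst.
- exists (fun j => H j.+1); first exact: derive_chain_shift.
  apply/funext => x; apply/funext => y.
  by rewrite /pd derive1E; have dHy := dH 0%N y; rewrite derive_val.
Qed.

Lemma smooth2_shear (G : nat -> R -> R) :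
  derive_chain G -> smooth2 (fun _ y => G 0%N y).
Proof.
move=> dG w; have [H dH ->] := iter_pd_shear w G dG; split.
- move=> p; apply: (@continuous_comp _ _ _ snd (H 0%N)); first exact: cvg_snd.
  apply/differentiable_continuous/derivable1_diffP.
  by have dHp := dH 0%N p.2; exact: ex_derive.
- move=> x y; split; first exact: derivable_cst.
  by have dHy := dH 0%N y; exact: ex_derive.
Qed.

Lemma smooth_per_shear L (G : nat -> R -> R) : derive_chain G ->
  (forall y, G 0%N (y + L) = G 0%N y) -> smooth_per L (shear (G 0%N)).
Proof.
move=> dG pG; split; first by move=> x y; rewrite /shear pG.
by split; [exact: smooth2_shear|exact: (smooth2_shear _ derive_chain0)].
Qed.

Lemma div_free_shear (f : R -> R) : div_free (shear f).
Proof. by move=> x y; rewrite /pd /comp1 /comp2 /= !derive1_cst addr0. Qed.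

End SmoothShear.

(** * Shear flows whose cosine coefficients decay faster than every power of distinct positive
    frequencies *)

Section LacunaryShear.
Context {R : realType}.
Variables (L : R) (c : nat -> R) (N : nat -> nat).
Hypotheses (L0 : 0 < L) (c0 : forall n, 0 <= c n) (N0 : forall n, (0 < N n)%N)
  (Ninj : injective N)
  (rapid : forall j, cvgn (series (fun n => c n * wave L (N n) ^+ j))).
Local Open Scope classical_set_scope.

Local Notation I f := (\int[lebesgue_measure]_(y in `[0, L]) f y).
Local Notation lam := (fun n => wave L (N n)).

Definition profile (y : R) : R := cosine_series c lam 0 y.

Definition partial_profile (M : nat) (y : R) : R :=
  \sum_(n < M) c n * cos (wave L (N n) * y).

Lemma wave_ge0 n : 0 <= wave L n.
Proof. by rewrite mulr_ge0// ltW// kappa0_gt0. Qed.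

Lemma cvg_coef : cvgn (series c).
Proof.
by have := rapid 0%N; congr (cvgn (series _)); apply/funext => n; rewrite mulr1.
Qed.

(** Each differentiation multiplies the coefficients by the frequencies and advances the phase by a
    quarter turn. Passing from [j] to [j.+1] uses summability at the exponents [j], [j + 1] and
    [j + 2]. *)
Lemma derive_chain_profile : derive_chain (fun j =>
  cosine_series (fun n => c n * lam n ^+ j) lam (j%:R * (pi / 2))).
Proof.
move=> j t.
have e k : (fun n => c n * lam n ^+ j * lam n ^+ k) =
    fun n => c n * lam n ^+ (j + k).
  by apply/funext => n; rewrite -mulrA -exprD.
have := @is_derive_cosine_series R (fun n => c n * lam n ^+ j) lam
  (j%:R * (pi / 2)) t.
have e1 := e 1%N; rewrite addn1 in e1.
rewrite -[j.+1%:R]natr1 [(j%:R + 1) * _]mulrDl mul1r -e1; apply.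
- by move=> n; rewrite mulr_ge0// exprn_ge0// wave_ge0.
- by move=> n; exact: wave_ge0.
- exact: rapid.
- by rewrite [X in series X]e1; exact: rapid.
- by rewrite e; exact: rapid.
Qed.

Lemma profileE : profile =
  cosine_series (fun n => c n * lam n ^+ 0) lam (0%:R * (pi / 2)).
Proof.
apply/funext => y; rewrite mul0r /profile; congr cosine_series.
by apply/funext => n; rewrite mulr1.
Qed.

Lemma profile_period y : profile (y + L) = profile y.
Proof.
rewrite /profile /cosine_series.
suff -> : (fun n => c n * cos (lam n * (y + L) + 0)) =
          (fun n => c n * cos (lam n * y + 0)) by [].
apply/funext => n; rewrite !addr0 mulrDr wave_period// periodicn//.
exact: cosD2pi.
Qed.

Lemma smooth_per_profile : smooth_per L (shear profile).
Proof.
rewrite profileE.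
apply: (smooth_per_shear L _ derive_chain_profile) => y.
by rewrite -profileE profile_period.
Qed.

Lemma continuous_profile : continuous profile.
Proof.
move=> y; apply/differentiable_continuous/derivable1_diffP; rewrite profileE.
by have dG := derive_chain_profile 0%N y; exact: ex_derive.
Qed.

Lemma continuous_partial_profile M : continuous (partial_profile M).
Proof.
elim: M => [|M IH] y.
  rewrite (_ : partial_profile 0 = cst 0); first exact: cvg_cst.
  by apply/funext => z; rewrite /partial_profile big_ord0.
rewrite (_ : partial_profile M.+1 =
    fun y => partial_profile M y + c M * cos (wave L (N M) * y)); last first.
  by apply/funext => z; rewrite /partial_profile big_ord_recr.
apply: cvgD; first exact: IH.
apply: cvgM; first exact: cvg_cst.
exact: continuous_cos_wave.
Qed.

Definition tail (M : nat) : R := limn (series c) - series c M.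

Lemma profile_tail M y : `|profile y - partial_profile M y| <= tail M.
Proof.
have := cosine_series_tail c lam 0 y M c0 cvg_coef.
congr (`|_ - _| <= _); apply: eq_bigr => n _; by rewrite addr0.
Qed.

Lemma tailL_cvg0 : tail M * L @[M --> \oo] --> 0.
Proof.
rewrite -[0](mul0r L); apply: cvgM; last exact: cvg_cst.
rewrite -[0](subrr (limn (series c))); apply: cvgB; first exact: cvg_cst.
exact: cvg_coef.
Qed.

(** The weight [f] is kept general to serve both the mean, with [f = 1], and the cosine
    coefficients. *)
Lemma Rintegral_partial_profile M (f : R -> R) : continuous f ->
  I (fun y => partial_profile M y * f y) =
  \sum_(n < M) c n * I (fun y => cos (wave L (N n) * y) * f y).
Proof.
move=> cf.
have cg n : continuous (fun y => cos (wave L n * y) * f y).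
  by move=> y; apply: cvgM; [exact: continuous_cos_wave|exact: cf].
elim: M => [|M IH].
  rewrite big_ord0 -[RHS](mul0r L) -(Rintegral_const _ L0).
  by apply: eq_Rintegral => y _; rewrite /partial_profile big_ord0 mul0r.
rewrite big_ord_recr/= -IH -RintegralZl//; last first.
  exact: integrable_continuous (cg _).
rewrite -RintegralD//; last 2 first.
- apply: (integrable_continuous _ (fun y => partial_profile M y * f y)) => y.
  by apply: cvgM; [exact: continuous_partial_profile|exact: cf].
- apply: (integrable_continuous _
    (fun y => c M * (cos (wave L (N M) * y) * f y))) => y.
  by apply: cvgM; [exact: cvg_cst|exact: cg].
apply: eq_Rintegral => y _.
by rewrite /partial_profile big_ord_recr/= mulrDl mulrA.
Qed.

Lemma Rintegral_partial_profile0 M : I (partial_profile M) = 0.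
Proof.
have -> : I (partial_profile M) = I (fun y => partial_profile M y * 1).
  by apply: eq_Rintegral => y _; rewrite mulr1.
rewrite (Rintegral_partial_profile M (cst 1)); last by move=> y; exact: cvg_cst.
rewrite big1// => n _.
rewrite [X in c n * X](_ : _ = 0) ?mulr0// -[RHS](Rintegral_cos_wave L L0 _ (N0 n)).
by apply: eq_Rintegral => y _; rewrite mulr1.
Qed.

(** For [M > n], orthogonality and injectivity of [N] give this value exactly for the partial sum.
    The truncation bound is uniform in [y], so the integrals differ by at most [tail M * L], which
    tends to 0. *)
Lemma profile_fourier n :
  I (fun y => profile y * cos (wave L (N n) * y)) = c n * (L / 2).
Proof.
pose f y := cos (wave L (N n) * y).
have cf : continuous f by exact: continuous_cos_wave.
have partial M : (n < M)%N ->
    I (fun y => partial_profile M y * f y) = c n * (L / 2).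
  move=> nM; rewrite Rintegral_partial_profile// (bigD1 (Ordinal nM))//=.
  rewrite (Rintegral_cos_wave_mul L L0)// eqxx mul1r big1 ?addr0// => m mn.
  rewrite (Rintegral_cos_wave_mul L L0)// (inj_eq Ninj).
  by rewrite -val_eqE/= in mn; rewrite (negbTE mn) mul0r mulr0.
have diff M : (n < M)%N ->
    `|I (fun y => profile y * f y) - c n * (L / 2)| <= tail M * L.
  move=> nM; rewrite -(partial M nM) -RintegralB//; last 2 first.
  - apply: (integrable_continuous _ (fun y => profile y * f y)) => y.
    by apply: cvgM; [exact: continuous_profile|exact: cf].
  - apply: (integrable_continuous _ (fun y => partial_profile M y * f y)) => y.
    by apply: cvgM; [exact: continuous_partial_profile|exact: cf].
  apply: (Rintegral_norm_le _ L0
     (fun y => profile y * f y - partial_profile M y * f y)).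
    move=> y; apply: cvgB; apply: cvgM; try exact: cf.
      exact: continuous_profile.
    exact: continuous_partial_profile.
  move=> y; rewrite -mulrBl normrM.
  apply: le_trans (profile_tail M y).
  by rewrite ler_piMr// cos_max.
apply/eqP; rewrite -subr_eq0 -normr_le0.
apply: (cvgr_to_ge tailL_cvg0); exists n.+1 => // M /= nM; exact: diff.
Qed.

Lemma phase_vertical n x y : phase L (0, Posz n) x y = wave L n * y.
Proof. by rewrite /phase /wave /= mul0r add0r mulrA. Qed.

Lemma ccoef_profile n :
  ccoef L (0, Posz (N n)) (comp1 (shear profile)) = c n * (L / 2) * L.
Proof.
rewrite -profile_fourier -(sq_int_shear L L0); congr sq_int.
by apply/funext => x; apply/funext => y; rewrite phase_vertical.
Qed.

(** The partial sums are the approximating trigonometric polynomials; the squared distance is at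
    most [(tail M * L) ^+ 2]. *)
Lemma inH_profile : inH L (shear profile).
Proof.
move=> eps eps0.
have cv : (tail M * L) ^+ 2 @[M --> \oo] --> 0.
  by rewrite -[0](mul0r 0); exact: cvgM tailL_cvg0 tailL_cvg0.
have [M _ HM] : \forall M \near \oo, (tail M * L) ^+ 2 < eps.
  exact: (cvgr_lt 0 cv).
have {}HM := HM M (leqnn M).
(* Vertical modes with cosine amplitude along the first axis and no sine part. *)
exists (mkseq (fun n => ((0, Posz (N n)), (c n, 0), (0, 0))) M).
rewrite (_ : trigpoly L _ = shear (partial_profile M)); last first.
  apply/funext => x; apply/funext => y; rewrite /trigpoly /shear /mkseq !big_map.
  congr pair.
  - rewrite -{1}[M]subn0 -/(index_iota 0 M) big_mkord; apply: eq_bigr => n _ /=.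
    by rewrite phase_vertical mulr0 addr0 mulrC.
  - by rewrite big1// => n _ /=; rewrite !mulr0 addr0.
split; first exact: div_free_shear.
split.
  split.
  - rewrite -[sq_int _ _]/(sq_int L (fun _ y => partial_profile M y)).
    by rewrite sq_int_shear// Rintegral_partial_profile0 mul0r.
  - rewrite -[sq_int _ _]/(sq_int L (fun _ y => 0)) sq_int_shear//.
    by rewrite Rintegral_const// !mul0r.
apply: le_lt_trans HM.
rewrite /L2dist2 -[sq_int _ _]/(sq_int L (fun _ y =>
  (profile y - partial_profile M y) ^+ 2 + (0 - 0) ^+ 2)) sq_int_shear//.
(* One factor [L] comes from the integral in [x] and is cancelled here; the other comes from the
   integral in [y]. *)
rewrite exprMn [L ^+ 2]expr2 mulrA ler_wpM2r ?(ltW L0)//.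
apply: (le_trans (ler_norm _)); apply: Rintegral_norm_le => // y.
- apply: cvgD; last exact: cvg_cst.
  by apply: cvgM; apply: cvgB;
    (exact: continuous_profile || exact: continuous_partial_profile).
- rewrite subrr expr0n/= addr0 normrX lerXn2r// ?nnegrE//; last exact: profile_tail.
  exact: le_trans (normr_ge0 _) (profile_tail M y).
Qed.

(** The sum over modes is a supremum over finite sets, so the singleton mode [(0, N n)] bounds it
    from below. *)
Lemma normA2_profile_ge alpha n :
  (((wave L (N n) ^+ 2) ^+ alpha * (c n * (L / 2)) ^+ 2)%:E <=
   normA2 L alpha (shear profile))%E.
Proof.
apply: esum_ge; exists [set (0%R, Posz (N n))].
  by split; [exact: finite_set1|].
rewrite fsbig_set1 lee_fin /= expr0n/= add0r -exprMn -/(wave L (N n)).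
rewrite ccoef_profile.
rewrite -[leRHS]mulrA ler_wpM2l ?exprn_ge0 ?wave_ge0//.
(* Division by [L ^+ 2] absorbs the last [L] of the coefficient [c n * (L / 2) * L]; the remaining
   coefficients enter as squares and are dropped. *)
rewrite ler_pdivlMr ?exprn_gt0// -exprMn -!addrA lerDl.
by rewrite !addr_ge0// sqr_ge0.
Qed.

End LacunaryShear.

(** * The concrete frequencies and amplitudes, and the growth comparisons between exponents *)

Section Coefficients.
Context {R : realType}.
Local Open Scope classical_set_scope.

Definition freq (n : nat) : nat := 2 ^ (n ^ 2).

Definition amp (n : nat) : R := (2 ^+ (n ^ 3))^-1.

Lemma freq_gt0 n : (0 < freq n)%N.
Proof. by rewrite expn_gt0. Qed.

Lemma freq_inj : injective freq.
Proof.
move=> m n /eqP; rewrite eqn_exp2l// => /eqP/eqP.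
by rewrite eqn_sqr => /eqP.
Qed.

Lemma amp_ge0 n : 0 <= amp n.
Proof. by rewrite invr_ge0 exprn_ge0. Qed.

(** Exponent form of the bound of [2^(n^2 j - n^3)] by [2^(j^3 + j)] times [2^(-n)]. For [n > j] the
    term [n^3] absorbs the left side; for [n <= j] the constant [j^3 + j] does. *)
Lemma cubic_dominates j n : (n ^ 2 * j + n <= n ^ 3 + (j ^ 3 + j))%N.
Proof.
have [jn|nj] := ltnP j n.
  have : (n * n * j.+1 <= n * n * n)%N by rewrite leq_mul2l jn orbT.
  by rewrite !expnS !expn0 !muln1; nia.
have h1 : (n * n <= j * j)%N by exact: leq_mul.
have : (n * n * j <= j * j * j)%N by rewrite leq_mul2r h1 orbT.
by rewrite !expnS !expn0 !muln1; nia.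
Qed.

Lemma amp_rapid (L : R) : 0 < L ->
  forall j, cvgn (series (fun n => amp n * wave L (freq n) ^+ j)).
Proof.
move=> L0 j.
pose C := kappa0 L ^+ j * 2 ^+ (j ^ 3 + j).
have k0 := kappa0_gt0 _ L0.
(* Comparison with a geometric series of ratio 1/2, whose constant [C] depends on [j] but not on
   [n]. *)
apply: (@series_le_cvg _ _ (geometric C 2^-1)) => [n|n|n|].
- by rewrite mulr_ge0 ?amp_ge0// exprn_ge0// wave_ge0.
- by rewrite geometric_ge0// mulr_ge0// exprn_ge0// ltW.
- rewrite /= /wave /freq /amp /C exprMn natrX -exprM mulrCA -mulrA.
  rewrite ler_wpM2l ?exprn_ge0 ?(ltW k0)//.
  rewrite exprVn ler_pdivlMr ?exprn_gt0// -mulrA mulrC ler_pdivrMr ?exprn_gt0//.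
  rewrite -!exprD ler_weXn2l ?ler1n// [leqRHS]addnC.
  exact: cubic_dominates.
- by apply: is_cvg_geometric_series; rewrite ger0_norm ?invr_ge0// invf_lt1 ?ltr1n.
Qed.

(** If [expR s <= 2 ^+ K], then for [n >= K] the exponential is at most [2 ^+ (n ^ 3)]. Cancelling
    this factor would leave [A * 2 ^+ (n ^ 3) <= |c|], which is false for large [n]. *)
Lemma cubic_exponential_unbounded (A c s : R) : 0 < A ->
  ~ (forall n, A * 2 ^+ (2 * n ^ 3) <= c * expR (s * n%:R ^+ 2)).
Proof.
move=> A0 H.
have lt2X (n : nat) : n%:R < 2 ^+ n :> R by rewrite -natrX ltr_nat ltn_expl.
pose K := (Num.truncn (expR s)).+1.
have sK : expR s <= 2 ^+ K.
  by apply: le_trans (ltW (truncnS_gt _)) (ltW (lt2X K)).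
pose m := (Num.truncn (`|c| / A)).+1.
(* One index meets both demands: [n >= K] tames the exponential, and [n >= m] makes
   [A * 2 ^+ (n ^ 3)] exceed [|c|]. *)
pose n := (K + m)%N.
have cn : `|c| < A * 2 ^+ (n ^ 3).
  rewrite mulrC -ltr_pdivrMr//; apply: (lt_le_trans (truncnS_gt _)).
  apply: le_trans (ltW (lt2X m)) _; rewrite ler_weXn2l ?ler1n//.
  by rewrite /n !expnS expn0; nia.
have : A * 2 ^+ (2 * n ^ 3) <= `|c| * 2 ^+ (n ^ 3).
  apply: le_trans (H n) _.
  apply: (@le_trans _ _ (`|c| * expR (s * n%:R ^+ 2))).
    by rewrite ler_wpM2r ?expR_ge0// ler_norm.
  rewrite ler_wpM2l// -natrX mulrC expRM_natl.
  apply: (@le_trans _ _ ((2 ^+ K) ^+ (n ^ 2))).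
    by rewrite lerXn2r ?nnegrE ?expR_ge0 ?exprn_ge0.
  rewrite -exprM ler_weXn2l ?ler1n// [(n ^ 3)%N]expnS leq_mul2r.
  by rewrite /n leq_addr orbT.
rewrite mul2n -addnn exprD mulrA ler_pM2r ?exprn_gt0//.
by rewrite leNgt cn.
Qed.

End Coefficients.

Theorem theorem10p1 (R : realType) (L nu : R) (hL : 0 < L) (hnu : 0 < nu) :
  (forall sigma : R, 0 < sigma ->
     forall u : @vfield R, classC L nu sigma u -> smooth_per L u /\ inH L u) /\
  (exists u : @vfield R, smooth_per L u /\ inH L u /\
     forall sigma : R, 0 < sigma -> ~ classC L nu sigma u).
Proof.
split; first by move=> sigma _ u [? [? _]].
have k0 := kappa0_gt0 _ hL.
exists (shear (profile L amp freq)); split.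
  exact: (smooth_per_profile _ _ _ hL amp_ge0 (amp_rapid _ hL)).
split.
  exact: (inH_profile _ _ _ hL amp_ge0 freq_gt0 (amp_rapid _ hL)).
move=> sigma _ [_ [_ [c0 H]]].
have A0 : 0 < (L / 2) ^+ 2 / nu ^+ 2 by rewrite divr_gt0// exprn_gt0// divr_gt0.
(* The choice [alpha = 2 * n] turns [sigma * alpha ^+ 2] into [4 * sigma * n ^+ 2]. The constant
   [(L / 2) ^+ 2 / nu ^+ 2] is what remains of the mode once the powers of [kappa0 L] cancel. *)
apply: (@cubic_exponential_unbounded R _ c0 (4 * sigma) A0) => n.
have := H (2 * n)%N.
have D0 : 0 <= (nu ^+ 2 * kappa0 L ^+ (2 * (2 * n)))^-1.
  by rewrite invr_ge0 mulr_ge0// exprn_ge0// ltW.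
have B := normA2_profile_ge _ _ _ hL amp_ge0 freq_gt0 freq_inj (amp_rapid _ hL) (2 * n) n.
have {}B := @lee_wpmul2r R (_%:E) D0 _ _ B.
move=> /(le_trans B).
rewrite -EFinM lee_fin.
rewrite (_ : sigma * (2 * n)%:R ^+ 2 = 4 * sigma * n%:R ^+ 2); last first.
  by rewrite natrM; ring.
apply: le_trans.
(* The two sides are in fact equal: the frequency contributes [2^(4 n^3)] and the squared amplitude
   [2^(-2 n^3)]. *)
rewrite le_eqVlt; apply/orP; left; apply/eqP.
have -> : wave L (freq n) ^+ 2 ^+ (2 * n) =
    kappa0 L ^+ (2 * (2 * n)) * (2 ^+ (2 * n ^ 3) * 2 ^+ (2 * n ^ 3)).
  rewrite -exprM /wave exprMn; congr (_ * _).
  rewrite /freq natrX -exprM -exprD; congr (_ ^+ _).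
  by rewrite !expnS expn0; nia.
have -> : (amp n * (L / 2)) ^+ 2 = (2 ^+ (2 * n ^ 3))^-1 * (L / 2) ^+ 2.
  by rewrite exprMn /amp exprVn -exprM [(n ^ 3 * 2)%N]mulnC.
have p0 : (2 ^+ (2 * n ^ 3) : R) != 0 by rewrite expf_neq0.
have q0 : kappa0 L ^+ (2 * (2 * n)) != 0 by rewrite expf_neq0// gt_eqF.
move: (2 ^+ _) (kappa0 L ^+ _) p0 q0 => p q p0 q0.
by field; rewrite p0 q0 gt_eqF.
Qed.
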